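(* The category $\mathsf{detSys}^{\mathsf{ef}}$ of nonempty deterministic dynamical systems with embedding-factor pairs as morphisms does not have a universal system; that is, there is no object $U$ of $\mathsf{detSys}^{\mathsf{ef}}$ such that for every object $A$ of $\mathsf{detSys}^{\mathsf{ef}}$ there is a morphism $A\to U$.
   Context: A deterministic system is a pair $(X,T)$ with $X$ a zero-dimensional (having a basis of clopen sets), second-countable, compact Hausdorff space and $T:X\to X$ continuous. A factor $f:(Y,S)\to(X,T)$ is a continuous surjection with $f\circ S=T\circ f$. An embedding-factor pair (ef-pair) $(e,f):(X,T)\to(Y,S)$ consists of a factor $f:(Y,S)\to(X,T)$ together with the multifunction $e:x\mapsto f^{-1}(x)$ from $X$ to $Y$ (the embedding uniquely determined by $f$); composition is $(e',f')\circ(e,f)=(e'\circ e,f\circ f')$. Thus a morphism $(X,T)\to(Y,S)$ of $\mathsf{detSys}^{\mathsf{ef}}$ amounts to a factor $(Y,S)\to(X,T)$. *)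

(* Defs.v *)
From mathcomp Require Import all_boot.
From mathcomp Require Import all_classical topology.

Set Implicit Arguments.
Unset Strict Implicit.
Unset Printing Implicit Defensive.

Local Open Scope classical_set_scope.

(** The library's [zero_dimensional] only asks that distinct points be
    separated by clopen sets; here the definition is by a basis of clopen
    sets. *)
Definition has_clopen_basis (X : topologicalType) : Prop :=
  exists2 B : set (set X), B `<=` clopen & basis B.

Record detSys := DetSys {
  space :> topologicalType;
  dyn : space -> space;
  detSys_clopen_basis : has_clopen_basis space;
  detSys_second_countable : @second_countable space;
  detSys_compact : compact [set: space];
  detSys_hausdorff : hausdorff_space space;
  dyn_continuous : continuous dyn }.

Record factor (Y X : detSys) := Factor {
  factor_fun :> Y -> X;
  factor_continuous : continuous factor_fun;
  factor_surj : set_surj [set: Y] [set: X] factor_fun;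
  factor_dyn : factor_fun \o @dyn Y = @dyn X \o factor_fun }.

(** An ef-pair from [X] to [Y]; the factor goes from [Y] to [X]. *)
Record ef_pair (X Y : detSys) := EfPair {
  ef_embedding : X -> set Y;
  ef_factor : factor Y X;
  ef_embeddingE : ef_embedding = fun x => ef_factor @^-1` [set x] }.

Definition multi_comp (X Y Z : Type) (e' : Y -> set Z) (e : X -> set Y) :
    X -> set Z :=
  fun x => \bigcup_(y in e x) e' y.

Lemma factor_eq (Y X : detSys) (f g : factor Y X) :
  factor_fun f = factor_fun g -> f = g.
Proof.
case: f g => f fc fs fd [g gc gs gd] /= fg; subst g.
by congr Factor; exact: Prop_irrelevance.
Qed.

Lemma ef_pair_eq (X Y : detSys) (p q : ef_pair X Y) :
  factor_fun (ef_factor p) = factor_fun (ef_factor q) -> p = q.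
Proof.
case: p q => e f ef [e' f' ef'] /= /factor_eq ff'; subst f' e e'.
by [].
Qed.

Lemma factor_id_surj (X : detSys) : set_surj [set: X] [set: X] id.
Proof. by move=> x _; exists x. Qed.

Definition factor_id (X : detSys) : factor X X :=
  @Factor X X id (fun x => cvg_id) (@factor_id_surj X) erefl.

Section FactorComp.
Variables (Z Y X : detSys) (f : factor Y X) (g : factor Z Y).

Lemma factor_comp_continuous : continuous (f \o g).
Proof.
by move=> z; apply: continuous_comp; exact: factor_continuous.
Qed.

Lemma factor_comp_surj : set_surj [set: Z] [set: X] (f \o g).
Proof.
move=> x /(@factor_surj _ _ f)[y _ <-].
by have [z _ <-] := @factor_surj _ _ g y I; exists z.
Qed.

Lemma factor_comp_dyn : (f \o g) \o @dyn Z = @dyn X \o (f \o g).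
Proof. by rewrite -compA factor_dyn compA factor_dyn. Qed.

Definition factor_comp : factor Z X :=
  Factor factor_comp_continuous factor_comp_surj factor_comp_dyn.

End FactorComp.

Lemma ef_id_embeddingE (X : detSys) :
  (fun x : X => [set x]) = fun x => factor_id X @^-1` [set x].
Proof. by []. Qed.

Definition ef_id (X : detSys) : ef_pair X X := EfPair (ef_id_embeddingE X).

Lemma ef_comp_embeddingE (X Y Z : detSys) (q : ef_pair Y Z) (p : ef_pair X Y) :
  multi_comp (ef_embedding q) (ef_embedding p) =
  fun x => factor_comp (ef_factor p) (ef_factor q) @^-1` [set x].
Proof.
apply/funext => x; rewrite /multi_comp !ef_embeddingE.
by apply/seteqP; split=> [z [y /= <- ->]//|z /= <-]; exists (ef_factor q z).
Qed.

Definition ef_comp (X Y Z : detSys) (q : ef_pair Y Z) (p : ef_pair X Y) :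
  ef_pair X Z := EfPair (ef_comp_embeddingE q p).

Record category := Category {
  obj :> Type;
  hom : obj -> obj -> Type;
  idm : forall A, hom A A;
  compm : forall A B C, hom B C -> hom A B -> hom A C;
  compm_id_left : forall A B (f : hom A B), compm (idm B) f = f;
  compm_id_right : forall A B (f : hom A B), compm f (idm A) = f;
  compmA : forall A B C D (h : hom C D) (g : hom B C) (f : hom A B),
    compm h (compm g f) = compm (compm h g) f }.

Definition universal (C : category) (U : C) : Prop :=
  forall A : C, inhabited (hom A U).

Record nonempty_detSys := NonemptyDetSys {
  nonempty_detSys_val :> detSys;
  nonempty_detSysP : [set: nonempty_detSys_val] !=set0 }.

Definition detSys_ef : category.
Proof.
refine (@Category nonempty_detSys (fun X Y => ef_pair X Y)
  (fun X => ef_id X) (fun X Y Z q p => ef_comp q p) _ _ _).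
- by move=> A B f; exact: ef_pair_eq.
- by move=> A B f; exact: ef_pair_eq.
- by move=> A B C D h g f; exact: ef_pair_eq.
Defined.

(* Main.v *)
(** A factor map from [U] onto a subshift [A] of the full one-sided shift on two
    symbols is determined by the clopen set of points of [U] whose image starts
    with the symbol 1: the itineraries through that set are exactly the points
    of [A]. A compact second-countable space has only countably many clopen sets,
    so [U] has only countably many subshift factors, whereas the subshifts
    [spaced S] for [S] a set of naturals are pairwise distinct and uncountably
    many. *)
From HB Require Import structures.
From mathcomp Require Import all_boot.
From mathcomp Require Import all_classical topology cantor.
Require Import Defs.

Set Implicit Arguments.
Unset Strict Implicit.
Unset Printing Implicit Defensive.

Local Open Scope classical_set_scope.

(** * Cylinders of the Cantor space and the shift *)

Definition cylinder (x : cantor_space) (n : nat) : set cantor_space :=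
  [set y | forall i, i < n -> y i = x i].

Lemma cylinder_clopen (x : cantor_space) (n : nat) : clopen (cylinder x n).
Proof.
elim: n => [|n IHn].
  have -> : cylinder x 0 = setT by apply/seteqP; split.
  exact: clopenT.
have -> : cylinder x n.+1 = cylinder x n `&` proj n @^-1` [set x n].
  apply/seteqP; split=> [y xy|y [xy yn] i].
    by split=> [i ltin|]; apply: xy => //; exact: ltnW.
  by rewrite ltnS leq_eqVlt => /predU1P[->//|]; exact: xy.
apply: clopenI => //; apply: preimage_clopen; last exact: proj_continuous.
by split; [exact: discrete_open|exact: discrete_closed].
Qed.

Lemma cylinder_nbhs (x : cantor_space) (n : nat) : nbhs x (cylinder x n).
Proof. by apply: open_nbhs_nbhs; split=> //; case: (cylinder_clopen x n). Qed.

(** The product topology is the supremum of the topologies pulled back along the coordinates, so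
    convergence of the cylinder filter to [x] can be tested one coordinate at a time. *)
Lemma nbhs_cylinder (x : cantor_space) (U : set cantor_space) :
  nbhs x U -> exists n, cylinder x n `<=` U.
Proof.
pose F := filter_from [set: nat] (cylinder x).
have FF : Filter F.
  apply: filter_from_filter; first by exists 0.
  move=> m n _ _; exists (maxn m n) => // y xy.
  by split=> i lti; apply: xy; rewrite leq_max lti ?orbT.
suff Fx : F --> x by move=> /Fx[n _ xU]; exists n.
apply/cvg_sup => i A [_ [[B oB <-] Bx BA]].
by exists i.+1 => // y xy; apply: BA; rewrite /= (xy i).
Qed.

(** A cylinder depends only on a finite word, and there are countably many words. *)
Lemma countable_cylinder :
  countable [set cylinder p.1 p.2 | p in [set: cantor_space * nat]].
Proof.
pose g (s : seq bool) : set cantor_space := cylinder (nth false s) (size s).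
apply: (@sub_countable _ _ _ (range g)); last first.
  exact: sub_countable (card_image_le _ _) (countableP _).
apply: subset_card_le => _ [[x n] _ <-] /=.
exists (mkseq x n) => //; rewrite /g size_mkseq.
by apply/seteqP; split=> y xy i ltin; rewrite xy ?nth_mkseq.
Qed.

Definition shift (x : cantor_space) : cantor_space := fun n => x n.+1.

Lemma shift_continuous : continuous shift.
Proof.
move=> x U /nbhs_cylinder[n xU]; apply: filterS (cylinder_nbhs x n.+1) => y xy.
by apply: xU => i ltin; exact: xy.
Qed.

(** * Subshifts as deterministic systems, and factors onto them *)

Section Subshift.
Variable A : set cantor_space.

Definition cylinder_trace : set (set A) :=
  [set set_val @^-1` cylinder p.1 p.2 | p in [set: cantor_space * nat]].

Lemma set_val_continuous : continuous (set_val : A -> cantor_space).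
Proof. exact: initial_continuous. Qed.

Lemma cylinder_trace_clopen : cylinder_trace `<=` clopen.
Proof.
move=> _ [[x n] _ <-]; apply: preimage_clopen; first exact: cylinder_clopen.
exact: set_val_continuous.
Qed.

Lemma cylinder_trace_basis : basis cylinder_trace.
Proof.
split=> [U /cylinder_trace_clopen[]//|x U [_ [[B oB <-] Bx BU]]].
have [n xB] : exists n, cylinder (set_val x) n `<=` B.
  by apply: nbhs_cylinder; exact: open_nbhs_nbhs.
exists (set_val @^-1` cylinder (set_val x) n).
  by split=> //; exists (set_val x, n).
by move=> y /xB By; exact: BU.
Qed.

Lemma set_type_clopen_basis : has_clopen_basis A.
Proof.
by exists cylinder_trace;
  [exact: cylinder_trace_clopen|exact: cylinder_trace_basis].
Qed.

Lemma set_type_second_countable : @second_countable A.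
Proof.
exists cylinder_trace; last exact: cylinder_trace_basis.
have -> : cylinder_trace = preimage set_val @`
    [set cylinder p.1 p.2 | p in [set: cantor_space * nat]].
  by rewrite image_comp.
apply: sub_countable countable_cylinder; exact: card_image_le.
Qed.

Lemma set_type_hausdorff : hausdorff_space A.
Proof.
move=> x y clxy; apply: val_inj; apply: cantor_space_hausdorff => B C xB yC.
have [z [Bz Cz]] := clxy _ _ (set_val_continuous xB) (set_val_continuous yC).
by exists (set_val z).
Qed.

Hypothesis closedA : closed A.

Lemma set_type_compact : compact [set: A].
Proof.
move=> F PF _; have cA : compact A.
  exact: subclosed_compact closedA cantor_space_compact _.
(* The filter pushed forward along [set_val] clusters at a point of [A], which lifts to a cluster
   point in the subtype. *)
have [|p [Ap clp]] := cA (set_val @ F) _.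
  by apply: (@filterS _ F _ setT) => [x _|]; [exact: set_valP|exact: filterT].
exists (SigSub (mem_set Ap)); split=> // B N FB [_ [[W oW <-] Wp WN]].
have FB' : (set_val @ F) (set_val @` B).
  by apply: (@filterS _ F _ B) FB => x Bx; exists x.
have [_ [[x Bx <-] Wx]] := clp _ _ FB' (open_nbhs_nbhs (conj oW Wp)).
by exists x; split=> //; exact: WN.
Qed.

Hypothesis shiftA : forall x, A x -> A (shift x).

Definition sub_shift (x : A) : A := SigSub (mem_set (shiftA (set_valP x))).

Lemma sub_shift_continuous : continuous sub_shift.
Proof.
apply: continuous_comp_initial => x.
apply: (@continuous_comp _ _ _ _ shift); last exact: shift_continuous.
exact: set_val_continuous.
Qed.

Definition subshift : detSys :=
  DetSys set_type_clopen_basis set_type_second_countable set_type_compact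
    set_type_hausdorff sub_shift_continuous.

(** Surjectivity writes each point of [A] as some [f u], and equivariance reads its [k]-th symbol as
    the initial symbol of the image of the [k]-th iterate of [u]. The right-hand side involves [f]
    only through one set, which therefore determines [A]. *)
Lemma subshift_factorE (U : detSys) (f : factor U subshift) :
  A = [set x | exists u, forall k,
    x k <-> [set v | set_val (f v) 0] (iter k (@dyn U) u)].
Proof.
have fE k u : set_val (f (iter k (@dyn U) u)) 0 = set_val (f u) k.
  elim: k u => [//|k IHk] u; rewrite iterSr IHk.
  by have /(congr1 (@^~ u)) /= -> := factor_dyn f.
apply/seteqP; split=> [x Ax|x [u xu]].
  have [u _ fu] := @factor_surj _ _ f (SigSub (mem_set Ax)) I.
  by exists u => k; rewrite /= fE fu.
suff -> : x = set_val (f u) by exact: set_valP.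
apply/funext => k; apply/idP/idP.
  by move=> /(xu k) /=; rewrite fE.
by rewrite -fE => /(xu k).
Qed.

Lemma subshift_symbol_clopen (U : detSys) (f : factor U subshift) :
  clopen [set v | set_val (f v) 0].
Proof.
apply: (@preimage_clopen _ _ f [set x : A | set_val x 0]); last first.
  exact: factor_continuous.
apply: (@preimage_clopen _ _ (fun x : A => proj 0 (set_val x)) [set true]).
  by split; [exact: discrete_open|exact: discrete_closed].
move=> x; apply: continuous_comp; first exact: set_val_continuous.
exact: proj_continuous.
Qed.

End Subshift.

(** * Uncountably many subshifts *)

(** These are spacing shifts. The successor leaves out distance zero, which every 1 realises with
    itself. *)
Definition spaced (S : set nat) : set cantor_space :=
  [set x | forall i n, x i -> x (i + n.+1) -> S n].

(** Each forbidden pair of 1s involves only two coordinates, hence excludes an open set. *)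
Lemma spaced_closed (S : set nat) : closed (spaced S).
Proof.
have -> : spaced S = \bigcap_(p in [set p : nat * nat | ~ S p.2])
    ~` (proj p.1 @^-1` [set true] `&` proj (p.1 + p.2.+1) @^-1` [set true]).
  apply/seteqP; split=> [x Sx [i n] nSn [xi xn]|x Sx i n xi xn].
    by apply: nSn; exact: Sx xi xn.
  by apply: contrapT => nSn; exact: (Sx (i, n)).
apply: closed_bigI => p _; apply: open_closedC.
by apply: openI; apply: open_comp => [? _|];
  [exact: proj_continuous|exact: discrete_open|
   exact: proj_continuous|exact: discrete_open].
Qed.

Lemma spaced_shift (S : set nat) x : spaced S x -> spaced S (shift x).
Proof. by move=> Sx i n; rewrite /shift -addSn; exact: Sx. Qed.

Lemma spaced_inj : injective spaced.
Proof.
suff sub S S' : spaced S = spaced S' -> S `<=` S'.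
  by move=> S S' eqS; apply/seteqP; split; exact: sub.
(* The 1s of [x] sit at [0] and [n.+1], so [n.+1] is their only positive distance, and [x] lies in a
   spacing shift exactly when [n] is in its set. *)
move=> eqS n Sn; pose x : cantor_space := fun i => (i == 0) || (i == n.+1).
suff Sx : spaced S x.
  by move: Sx; rewrite eqS => /(_ 0 n); apply; rewrite /x ?eqxx ?orbT.
move=> i m; rewrite /x addnS /= eqSS => /orP[/eqP->|/eqP->] /eqP.
  by rewrite add0n => ->.
by rewrite addSn => /eqP; rewrite -addSn gtn_eqF // leq_addr.
Qed.

Definition spaced_shift_system (S : set nat) : detSys :=
  subshift (@spaced_closed S) (@spaced_shift S).

Lemma spaced_nonempty (S : set nat) : [set: spaced_shift_system S] !=set0.
Proof.
have S0 : spaced S (fun=> false) by [].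
by exists (SigSub (mem_set S0)).
Qed.

(** * The counting argument *)

Lemma countable_clopen (U : nonempty_detSys) : countable (@clopen U).
Proof.
have [u _] := nonempty_detSysP U.
(* [clopen_countable] is applied to a pointed space; nonemptiness supplies the point. *)
pose PU : ptopologicalType := HB.pack (space U) (isPointed.Build (space U) u).
exact: (@clopen_countable PU (@detSys_compact U) (@detSys_second_countable U)).
Qed.

(** Cantor's diagonal argument: [D] collects the codes of the sets that miss their own code. *)
Lemma set_nat_not_injective (g : set nat -> nat) : ~ injective g.
Proof.
move=> injg; pose D := [set n | exists2 S : set nat, g S = n & ~ S n].
have nD : ~ D (g D) by move=> [S /injg ->] /[dup] nD; apply; exists D.
by apply: (nD); exists D.
Qed.

Theorem proposition8p2 : ~ (exists U : detSys_ef, universal U).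
Proof.
move=> [U univU].
pose A S : detSys_ef := NonemptyDetSys (@spaced_nonempty S).
(* A morphism from [A S] to [U] carries a factor in the opposite direction; choice selects one for
   each [S]. *)
have f_ (S : set nat) : factor U (spaced_shift_system S).
  have /cid[p _] : exists p : hom (A S) U, True.
    by have [p] := univU (A S); exists p.
  exact: ef_factor p.
pose C S := [set v | set_val (f_ S v) 0].
have clC S : clopen (C S) by exact: subshift_symbol_clopen.
have injC : injective C.
  move=> S S' eqC; apply: spaced_inj.
  rewrite (subshift_factorE (f_ S)) (subshift_factorE (f_ S')).
  by rewrite -/(C S) -/(C S') eqC.
have /countable_injP[g injg] := countable_clopen U.
apply: (@set_nat_not_injective (g \o C)) => S S' /= /injg eqC.
by apply: injC; apply: eqC; rewrite inE.
Qed.
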